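(* Let $\mathcal{H}$ be a real Hilbert space, let $f\in\Gamma_0(\mathcal{H})$ with perspective $\widetilde{f}$, let $(x,\eta,\delta)\in\mathcal{H}\times\mathbb{R}\times\mathbb{R}$ be such that $\widetilde{f}\big(P_{\overline{\operatorname{dom}}\,\widetilde{f}}(x,\eta)\big)>\delta$, let $(x^*,\eta^*,\delta^* )=P_{\operatorname{epi}\widetilde{f}}(x,\eta,\delta)$, and let $(\bar{x},\bar{\eta},\bar{\delta})$ be the vector obtained by the bisection algorithm described in the context, run on $(x,\eta,\delta)$ with tolerance $\epsilon>0$. Then $$|\delta^*-\bar{\delta}|\le\epsilon\quad\text{and}\quad\|(x^*,\eta^* )-(\bar{x},\bar{\eta})\|\le\frac{\epsilon}{\bar{\delta}-\delta}\,\|(x,\eta)-(\bar{x},\bar{\eta})\|.$$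
   Context: **Notation.** $\Gamma_0(\mathcal{H})$ is the class of proper lower semicontinuous convex functions from the real Hilbert space $\mathcal{H}$ to $]-\infty,+\infty]$; $\operatorname{dom} f=\{x : f(x)<+\infty\}$ and $\overline{\operatorname{dom}}\,f$ is its closure. The conjugate is $f^*(u)=\sup_{x\in\mathcal{H}}(\langle x,u\rangle-f(x))$. The recession function is $(\operatorname{rec} f)(x)=\lim_{t\to+\infty}\frac{f(x_0+tx)-f(x_0)}{t}$, for any $x_0\in\operatorname{dom} f$ (independent of $x_0$). The perspective $\widetilde{f}\colon\mathcal{H}\times\mathbb{R}\to\,]-\infty,+\infty]$ is $\widetilde{f}(x,\eta)=\eta f(x/\eta)$ if $\eta>0$, $\widetilde{f}(x,0)=(\operatorname{rec} f)(x)$, and $\widetilde{f}(x,\eta)=+\infty$ if $\eta<0$; it belongs to $\Gamma_0(\mathcal{H}\oplus\mathbb{R})$ (Hilbert direct sum, $\|(x,\eta)\|^2=\|x\|^2+\eta^2$). $\operatorname{epi}\widetilde{f}=\{(x,\eta,\delta)\in\mathcal{H}\times\mathbb{R}\times\mathbb{R} : \widetilde{f}(x,\eta)\le\delta\}$. $\operatorname{prox}_g(z)$ is the unique minimizer of $y\mapsto g(y)+\frac12\|z-y\|^2$ and $P_C$ is the projection onto a nonempty closed convex set $C$. **Auxiliary functions.** For $\mu>0$ set $\phi(\mu)=\mu+\delta-\widetilde{f}\big(\operatorname{prox}_{\mu\widetilde{f}}(x,\eta)\big)$. For $\mu>0$ such that $\eta+\mu f^*\big(P_{\overline{\operatorname{dom}}\,f^*}(x/\mu)\big)>0$,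 set $\psi_\mu(\nu)=\nu-\eta-\mu f^*\big(\operatorname{prox}_{\frac{\nu}{\mu}f^*}(x/\mu)\big)$ for $\nu\in\big]0,\eta+\mu f^*(P_{\overline{\operatorname{dom}}\,f^*}(x/\mu))\big]\cap\mathbb{R}$; the equation $\psi_\mu(\nu)=0$ has a unique solution in this set. **Bisection algorithm**, with tolerance $\epsilon>0$, for $(x,\eta,\delta)$ with $\widetilde{f}(P_{\overline{\operatorname{dom}}\,\widetilde{f}}(x,\eta))>\delta$: 1. Set $\mu_-^0=0$. Set $\mu_+^0=-\delta+\widetilde{f}(P_{\overline{\operatorname{dom}}\,\widetilde{f}}(x,\eta))$ if $P_{\overline{\operatorname{dom}}\,\widetilde{f}}(x,\eta)\in\operatorname{dom}\widetilde{f}$; otherwise $\mu_+^0=N^k$, where $N>1$ and $k\in\mathbb{N}$ is the first integer satisfying $\phi(N^k)>0$ (such a $k$ exists). 2. Set $m=[\log_2(\mu_+^0/\epsilon)]$, where $[\cdot]$ is the integer part. 3. For $n=0$ to $m$: set $\hat\mu^{n+1}=(\mu_+^n+\mu_-^n)/2$. - If $\eta+\hat\mu^{n+1}f^*\big(P_{\overline{\operatorname{dom}}\,f^*}(x/\hat\mu^{n+1})\big)\le0$: set $(\bar{x},\bar{\eta})=\big(\operatorname{prox}_{\hat\mu^{n+1}(\operatorname{rec} f)}x,0\big)$; if $\hat\mu^{n+1}+\delta-(\operatorname{rec} f)(\bar{x})>0$ set $\mu_+^{n+1}=\hat\mu^{n+1}$ (and $\mu_-^{n+1}=\mu_-^n$),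 otherwise set $\mu_-^{n+1}=\hat\mu^{n+1}$ (and $\mu_+^{n+1}=\mu_+^n$). - Otherwise: let $\hat\nu^{n+1}$ be the solution to $\psi_{\hat\mu^{n+1}}(\nu)=0$ and set $(\bar{x},\bar{\eta})=\Big(\hat\nu^{n+1}\operatorname{prox}_{\frac{\hat\mu^{n+1}}{\hat\nu^{n+1}}f}\big(\tfrac{x}{\hat\nu^{n+1}}\big),\hat\nu^{n+1}\Big)$; if $\hat\mu^{n+1}+\delta-\bar{\eta}f(\bar{x}/\bar{\eta})>0$ set $\mu_+^{n+1}=\hat\mu^{n+1}$ (and $\mu_-^{n+1}=\mu_-^n$), otherwise set $\mu_-^{n+1}=\hat\mu^{n+1}$ (and $\mu_+^{n+1}=\mu_+^n$). 4. Set $\bar{\delta}=\delta+\hat\mu^{m+1}$ and return $(\bar{x},\bar{\eta},\bar{\delta})$, with $(\bar{x},\bar{\eta})$ the last computed pair. *)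

(* Defs.v *)
From HB Require Import structures.
From mathcomp Require Import all_boot all_order all_algebra sesquilinear.
From mathcomp Require Import ring.
From mathcomp Require Import all_classical all_reals all_analysis.

Set Implicit Arguments.
Unset Strict Implicit.
Unset Printing Implicit Defensive.

Import Order.TTheory GRing.Theory Num.Theory.
Import numFieldNormedType.Exports.

Local Open Scope classical_set_scope.
Local Open Scope ring_scope.

(* The library normed product V * W carries the max norm; [hsum V W] is the
   same module with the norm of the Hilbert direct sum. *)
Definition hsum (R : realType) (V W : normedModType R) : Type := (V * W)%type.

Section HilbertSum.
Context {R : realType} {V W : normedModType R}.

HB.instance Definition _ := GRing.Lmodule.copy (hsum V W) (V * W)%type.

Definition hsum_norm (z : hsum V W) : R :=
  Num.sqrt (`|z.1| ^+ 2 + `|z.2| ^+ 2).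

Let le_dot2 (a b c d : R) :
  a * b + c * d <= Num.sqrt (a ^+ 2 + c ^+ 2) * Num.sqrt (b ^+ 2 + d ^+ 2).
Proof.
rewrite -sqrtrM ?addr_ge0 ?sqr_ge0//; apply: le_trans (ler_norm _) _.
rewrite -sqrtr_sqr ler_sqrt ?mulr_ge0 ?addr_ge0 ?sqr_ge0//.
rewrite -subr_ge0; suff -> : (a ^+ 2 + c ^+ 2) * (b ^+ 2 + d ^+ 2)
  - (a * b + c * d) ^+ 2 = (a * d - c * b) ^+ 2 by exact: sqr_ge0.
by rewrite !expr2; ring.
Qed.

Lemma hsum_normD (y z : hsum V W) :
  hsum_norm (y + z) <= hsum_norm y + hsum_norm z.
Proof.
have sq (a b : R) : 0 <= a ^+ 2 + b ^+ 2 by rewrite addr_ge0 ?sqr_ge0.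
rewrite -[leRHS]ger0_norm ?addr_ge0 ?sqrtr_ge0// -sqrtr_sqr.
rewrite ler_sqrt ?sqr_ge0// sqrrD !sqr_sqrtr//.
have le1 : `|(y + z).1| ^+ 2 <= (`|y.1| + `|z.1|) ^+ 2.
  by rewrite ler_sqr ?nnegrE ?addr_ge0//; exact: ler_normD.
have le2 : `|(y + z).2| ^+ 2 <= (`|y.2| + `|z.2|) ^+ 2.
  by rewrite ler_sqr ?nnegrE ?addr_ge0//; exact: ler_normD.
apply: le_trans (lerD le1 le2) _; have := le_dot2 `|y.1| `|z.1| `|y.2| `|z.2|.
rewrite -/(hsum_norm y) -/(hsum_norm z) => le12.
rewrite -subr_ge0 (_ : _ - _ = (hsum_norm y * hsum_norm z
  - (`|y.1| * `|z.1| + `|y.2| * `|z.2|)) *+ 2).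
  by rewrite mulrn_wge0// subr_ge0.
by rewrite !sqrrD; ring.
Qed.

Lemma hsum_normZ (a : R) (z : hsum V W) :
  hsum_norm (a *: z) = `|a| * hsum_norm z.
Proof.
rewrite /hsum_norm /= !normrZ !exprMn -mulrDr sqrtrM ?sqr_ge0//.
by rewrite sqrtr_sqr normr_id.
Qed.

Lemma hsum_norm0_eq0 (z : hsum V W) : hsum_norm z = 0 -> z = 0.
Proof.
case: z => v w /eqP; rewrite sqrtr_eq0 /= => le0.
have : `|v| ^+ 2 + `|w| ^+ 2 == 0 by rewrite eq_le le0 addr_ge0 ?sqr_ge0.
rewrite paddr_eq0 ?sqr_ge0// !sqrf_eq0 !normr_eq0.
by move=> /andP[/eqP -> /eqP ->].
Qed.

HB.instance Definition _ := Lmodule_isNormed.Build R (hsum V W)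
  hsum_normD hsum_normZ hsum_norm0_eq0.

End HilbertSum.

Section ConvexAnalysis.
Context {R : realType} {V : normedModType R}.
Implicit Types (g : V -> \bar R) (C : set V).

Definition edom g : set V := [set y | (g y < +oo)%E].

Definition epi g : set (hsum V R^o) := [set z | (g z.1 <= z.2%:E)%E].

Definition proper_fun g := (forall y, g y != -oo%E) /\ edom g !=set0.

Definition convex_ereal g := forall (y z : V) (t : R), 0 < t < 1 ->
  (g (t *: y + (1 - t) *: z)%R <= t%:E * g y + (1 - t)%:E * g z)%E.

Definition Gamma0 g :=
  [/\ proper_fun g, lower_semicontinuous g & convex_ereal g].

(* [prox] and [proj_set] take the junk value 0 when no minimizer exists; for
   g in Gamma0, resp. C nonempty closed convex, in a Hilbert space, the
   minimizer exists and is unique. *)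
Definition prox g (z : V) : V :=
  xget 0 [set p | forall y, (g p + (2^-1 * `|z - p| ^+ 2)%:E
                             <= g y + (2^-1 * `|z - y| ^+ 2)%:E)%E].

Definition proj_set C (z : V) : V :=
  xget 0 [set p | C p /\ forall y, C y -> `|z - p| <= `|z - y|].

(* For g in Gamma0, the limit does not depend on the point of [edom g]. *)
Definition recession g (y : V) : \bar R :=
  let x0 := xget 0 (edom g) in
  lim ((t^-1%:E * (g (x0 + t *: y)%R - g x0))%E @[t --> +oo%R]).

Definition persp g (z : hsum V R^o) : \bar R :=
  if 0 < z.2 then (z.2%:E * g (z.2^-1 *: z.1))%E
  else if z.2 == 0 then recession g z.1
  else +oo%E.

Definition fenchel_conj (dot : V -> V -> R) g (u : V) : \bar R :=
  ereal_sup [set ((dot y u)%:E - g y)%E | y in [set: V]].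

End ConvexAnalysis.

Section Bisection.
Context {R : realType} {H : completeNormedModType R}.
Variables (dot : H -> H -> R) (f : H -> \bar R) (x : H) (eta delta : R).

Local Notation fc := (fenchel_conj dot f).
Local Notation z := ((x, eta) : hsum H R^o).
Local Notation p0 := (proj_set (closure (edom (persp f))) z).

Definition phi (mu : R) : \bar R :=
  ((mu + delta)%:E - persp f (prox (fun w => mu%:E * persp f w)%E z))%E.

Definition nu_max (mu : R) : \bar R :=
  (eta%:E + mu%:E * fc (proj_set (closure (edom fc)) (mu^-1 *: x)))%E.

Definition psi (mu nu : R) : \bar R :=
  ((nu - eta)%:E
   - mu%:E * fc (prox (fun u => (nu / mu)%:E * fc u)%E (mu^-1 *: x)))%E.

Definition nu_hat (mu : R) : R :=
  xget 1 [set nu | [/\ 0 < nu, (nu%:E <= nu_max mu)%E & psi mu nu = 0%E]].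

Definition bar_pair (mu : R) : hsum H R^o :=
  if (nu_max mu <= 0)%E then
    (prox (fun y => mu%:E * recession f y)%E x, 0)
  else
    let nu := nu_hat mu in
    (nu *: prox (fun y => (mu / nu)%:E * f y)%E (nu^-1 *: x), nu).

Definition bar_test (mu : R) : bool :=
  let: (xb, etab) := bar_pair mu in
  if (nu_max mu <= 0)%E then (0 < (mu + delta)%:E - recession f xb)%E
  else (0 < (mu + delta)%:E - etab%:E * f (etab^-1 *: xb))%E.

Definition first_exponent (N : R) : nat :=
  xget 0%N [set k | (0 < phi (N ^+ k))%E /\
                    forall j, (j < k)%N -> ~ (0 < phi (N ^+ j))%E].

Definition mu_plus0 (N : R) : R :=
  if p0 \in edom (persp f) then - delta + fine (persp f p0)
  else N ^+ first_exponent N.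

Definition midpoint (b : R * R) : R := (b.2 + b.1) / 2.

Definition bisect (b : R * R) : R * R :=
  let mu := midpoint b in
  if bar_test mu then (b.1, mu) else (mu, b.2).

(* The pair (mu_-^n, mu_+^n). *)
Definition bracket (N : R) (n : nat) : R * R := iter n bisect (0, mu_plus0 N).

(* [Num.truncn] is the integer part of a nonnegative real and is 0 on negative
   ones: when mu_+^0 < eps, one pass of the loop is still performed. *)
Definition last_step (N eps : R) : nat :=
  Num.truncn (ln (mu_plus0 N / eps) / ln 2).

(* The pass n = m of the loop uses mu^{m+1}, the midpoint of the n-th bracket,
   and it is the one whose pair is returned. *)
Definition bisection (N eps : R) : hsum (hsum H R^o) R^o :=
  let mu := midpoint (bracket N (last_step N eps)) in
  (bar_pair mu, delta + mu).

End Bisection.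

(* Main.v *)
Require Import Defs.
From HB Require Import structures.
From mathcomp Require Import all_boot all_order all_algebra sesquilinear.
From mathcomp Require Import ring lra.
From mathcomp Require Import all_classical all_reals all_analysis.
Import Order.TTheory GRing.Theory Num.Theory.
Import numFieldNormedType.Exports.
Local Open Scope classical_set_scope.
Local Open Scope ring_scope.

Set Implicit Arguments.
Unset Strict Implicit.
Unset Printing Implicit Defensive.

(* Write g for the perspective of f and z = (x, eta). Projecting (z, delta) onto
   the epigraph of g yields (prox_{mus g} z, delta + mus), where mus > 0 is
   characterized by g (prox_{mu g} z) < delta + mu <-> mus < mu, because the
   values g (prox_{mu g} z) do not increase with mu. The pair computed for mu is
   prox_{mu g} z: g is the support function of the reflected epigraph of the
   conjugate of f, so by Moreau's decomposition the prox reduces to a projection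
   onto the epigraph of the conjugate, whose two cases are the two branches of
   the loop. Hence the bisection brackets mus, and monotonicity of the
   subdifferential gives the bound
   |prox_{l g} z - prox_{l' g} z| <= |l - l'| / l' * |z - prox_{l' g} z|. *)

(** * Inner products, on a space and on the Hilbert sum *)

Record inner_product (R : realType) (V : normedModType R) (ip : V -> V -> R) :
    Prop := InnerProduct {
  ipC : forall y z, ip y z = ip z y;
  ipDl : forall y y' z, ip (y + y') z = ip y z + ip y' z;
  ipZl : forall a y z, ip (a *: y) z = a * ip y z;
  ip_norm : forall y, ip y y = `|y| ^+ 2 }.

Section InnerProductTheory.
Context {R : realType} {V : normedModType R} {ip : V -> V -> R}.
Hypothesis ipP : inner_product ip.
Implicit Types (y z u : V) (a : R).

Lemma ipDr y z u : ip y (z + u) = ip y z + ip y u.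
Proof. by rewrite !(ipC ipP y) (ipDl ipP). Qed.

Lemma ipZr a y z : ip y (a *: z) = a * ip y z.
Proof. by rewrite !(ipC ipP y) (ipZl ipP). Qed.

Lemma ipNl y z : ip (- y) z = - ip y z.
Proof. by rewrite -scaleN1r (ipZl ipP) mulN1r. Qed.

Lemma ipNr y z : ip y (- z) = - ip y z.
Proof. by rewrite !(ipC ipP y) ipNl. Qed.

Lemma ip0l z : ip 0 z = 0.
Proof. by rewrite -(scale0r 0) (ipZl ipP) mul0r. Qed.

Lemma ip0r z : ip z 0 = 0.
Proof. by rewrite (ipC ipP) ip0l. Qed.

Definition ipE := (ipDl ipP, ipDr, ipNl, ipNr, ipZl ipP, ipZr, ip0l, ip0r).

Lemma norm2_ip y : `|y| ^+ 2 = ip y y.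
Proof. by rewrite (ip_norm ipP). Qed.

Lemma ip_ge0 y : 0 <= ip y y.
Proof. by rewrite (ip_norm ipP) sqr_ge0. Qed.

Lemma ip_eq0 y : ip y y <= 0 -> y = 0.
Proof.
rewrite (ip_norm ipP) => y0; apply/eqP; rewrite -normr_eq0 -sqrf_eq0.
by rewrite eq_le y0 sqr_ge0.
Qed.

Lemma ip_le y z : ip y z <= `|y| * `|z|.
Proof.
have [->|z0] := eqVneq z 0; first by rewrite ip0r normr0 mulr0.
have n0 : 0 < `|z| by rewrite normr_gt0.
have [->|y0] := eqVneq y 0; first by rewrite ip0l normr0 mul0r.
have m0 : 0 < `|y| by rewrite normr_gt0.
(* Expanding this square and dividing by 2 |y| |z| gives the Cauchy-Schwarz inequality. *)
have := ip_ge0 (`|z| *: y - `|y| *: z).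
rewrite !ipE (ipC ipP z y) !(ip_norm ipP) => h.
rewrite -(ler_pM2l (mulr_gt0 m0 n0)) -subr_ge0.
set a := `|y| in h *; set b := `|z| in h *; lra.
Qed.

Lemma ip_norm_le y z : `|ip y z| <= `|y| * `|z|.
Proof.
by rewrite ler_norml ip_le andbT lerNl -ipNl -(normrN y) ip_le.
Qed.

End InnerProductTheory.

Lemma dot_inner_product (R : realType) (V : normedModType R)
    (dot : {dot V for idfun}) :
  (forall y : V, `|y| ^+ 2 = dot y y) -> inner_product dot.
Proof.
move=> dotN; split=> //.
- by move=> y z; rewrite (@hermC _ false) expr0 mul1r.
- by move=> y y' z; rewrite linearDl.
- by move=> a y z; rewrite linearZl.
Qed.

Definition hsum_ip (R : realType) (V W : normedModType R)
    (ipV : V -> V -> R) (ipW : W -> W -> R) (y z : hsum V W) : R :=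
  ipV y.1 z.1 + ipW y.2 z.2.

Lemma hsum_inner_product (R : realType) (V W : normedModType R)
    (ipV : V -> V -> R) (ipW : W -> W -> R) :
  inner_product ipV -> inner_product ipW -> inner_product (hsum_ip ipV ipW).
Proof.
move=> VP WP; split.
- by move=> y z; rewrite /hsum_ip (ipC VP) (ipC WP).
- by move=> y y' z; rewrite /hsum_ip (ipDl VP) (ipDl WP) addrACA.
- by move=> a y z; rewrite /hsum_ip (ipZl VP) (ipZl WP) mulrDr.
- move=> y; rewrite /hsum_ip (ip_norm VP) (ip_norm WP).
  by rewrite sqr_sqrtr// addr_ge0// sqr_ge0.
Qed.

Lemma mul_inner_product (R : realType) :
  @inner_product R R^o (fun a b : R => a * b).
Proof.
split.
- by move=> y z; rewrite mulrC.
- by move=> y y' z; rewrite mulrDl.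
- by move=> a y z; rewrite mulrA.
- by move=> y; rewrite real_normK ?num_real// expr2.
Qed.

(** * Completeness of the Hilbert sum *)

Section HsumComplete.
Context {R : realType} {V W : normedModType R}.

Lemma hsum_norm1 (z : hsum V W) : `|z.1| <= `|z|.
Proof.
rewrite -[leLHS]ger0_norm// -sqrtr_sqr ler_sqrt ?addr_ge0 ?sqr_ge0//.
by rewrite lerDl sqr_ge0.
Qed.

Lemma hsum_norm2 (z : hsum V W) : `|z.2| <= `|z|.
Proof.
rewrite -[leLHS]ger0_norm// -sqrtr_sqr ler_sqrt ?addr_ge0 ?sqr_ge0//.
by rewrite lerDr sqr_ge0.
Qed.

Lemma hsum_norm_le (z : hsum V W) : `|z| <= `|z.1| + `|z.2|.
Proof.
rewrite -[leRHS]ger0_norm ?addr_ge0// -sqrtr_sqr.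
rewrite ler_sqrt ?sqr_ge0// sqrrD -addrA lerD2l lerDr.
by rewrite mulrn_wge0// mulr_ge0.
Qed.

End HsumComplete.

Section HsumCompleteInstance.
Context {R : realType} {V W : completeNormedModType R}.

(** Each coordinate is dominated by the norm of the sum, so the coordinate filters are Cauchy.
    Completeness opens the results on prox and projections to [persp f] and to epigraphs. *)
Let hsum_cauchy_cvg (F : set_system (hsum V W)) :
  ProperFilter F -> cauchy F -> cvg F.
Proof.
move=> FF /cauchyP Fc.
have c1 : cvg (fmap (fun z : hsum V W => z.1) F).
  apply: cauchy_cvg; apply: cauchy_exP => e e0; have [z Fz] := Fc e e0.
  exists z.1; suff : F [set y | ball z.1 e y.1] by [].
  apply: filterS Fz => y; rewrite -!ball_normE /= => h.
  by apply: le_lt_trans h; exact: (hsum_norm1 (z - y)).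
have c2 : cvg (fmap (fun z : hsum V W => z.2) F).
  apply: cauchy_cvg; apply: cauchy_exP => e e0; have [z Fz] := Fc e e0.
  exists z.2; suff : F [set y | ball z.2 e y.2] by [].
  apply: filterS Fz => y; rewrite -!ball_normE /= => h.
  by apply: le_lt_trans h; exact: (hsum_norm2 (z - y)).
move/cvg_ex: c1 => [a Fa]; move/cvg_ex: c2 => [b Fb].
apply/cvg_ex; exists ((a, b) : hsum V W).
apply/(@cvgrPdist_lt _ (hsum V W) _ F _ id) => e e0.
have e2 : 0 < e / 2 by rewrite divr_gt0.
move/cvgrPdist_lt: (Fa) => /(_ _ e2) F1; move/cvgrPdist_lt: (Fb) => /(_ _ e2) F2.
apply: filterS2 F1 F2 => y /= h1 h2.
apply: le_lt_trans (hsum_norm_le _) _.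
by rewrite [ltRHS]splitr ltrD.
Qed.

HB.instance Definition _ :=
  Uniform_isComplete.Build (hsum V W) hsum_cauchy_cvg.

End HsumCompleteInstance.

(** * Growth and scaling of functions in [Gamma0] *)

Section ConvexFunctions.
Context {R : realType} {V : normedModType R}.
Implicit Types (g : V -> \bar R) (y z p : V) (a b r : R).

Lemma proper_fun_fin g : proper_fun g -> exists y a, g y = a%:E.
Proof.
move=> [gN [y]]; rewrite /edom /=; case E : (g y) => [a| |] // _.
  by exists y, a.
by move: (gN y); rewrite E.
Qed.

Lemma Gamma0_le_fin g y r : Gamma0 g -> (g y <= r%:E)%E ->
  exists2 a, g y = a%:E & a <= r.
Proof.
move=> [[gN _] _ _]; have := gN y; case: (g y) => [a| |] // _.
by rewrite lee_fin; exists a.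
Qed.

Lemma lsc_ball g y a : lower_semicontinuous g -> (a%:E < g y)%E ->
  exists2 e, 0 < e & forall y', `|y - y'| < e -> (a%:E < g y')%E.
Proof.
move=> gl /gl[B /nbhs_normP[e /= e0 eB] gB].
by exists e => // y' yy'; apply: gB; apply: eB.
Qed.

Lemma ball_lsc g : (forall y a, (a%:E < g y)%E ->
    exists2 e, 0 < e & forall y', `|y - y'| < e -> (a%:E < g y')%E) ->
  lower_semicontinuous g.
Proof.
move=> gl y a /gl[e e0 ge]; exists (ball_ Num.norm y e) => //.
by apply/nbhs_normP; exists e.
Qed.

Lemma convex_ereal_le g y z t a b : convex_ereal g -> 0 <= t <= 1 ->
  (g y <= a%:E)%E -> (g z <= b%:E)%E ->
  (g (t *: y + (1 - t) *: z)%R <= (t * a + (1 - t) * b)%R%:E)%E.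
Proof.
move=> gc /andP[t0 t1] ga gb.
have [->|tn0] := eqVneq t 0.
  by rewrite scale0r add0r subr0 scale1r mul0r add0r mul1r.
have [->|tn1] := eqVneq t 1.
  by rewrite subrr scale0r addr0 scale1r mul1r mul0r addr0.
have tp : 0 < t by rewrite lt_neqAle eq_sym tn0.
have tl : t < 1 by rewrite lt_neqAle tn1.
apply: le_trans (gc y z t _) _; first by rewrite tp.
rewrite [leRHS]EFinD !EFinM; apply: leeD; apply: lee_wpmul2l => //.
by rewrite lee_fin subr_ge0 ltW.
Qed.

(** Testing convexity on real upper bounds keeps the later proofs inside R; an infinite value makes
    the right-hand side infinite. *)
Lemma le_convex_ereal g : (forall y, g y != -oo%E) ->
  (forall y z t a b, 0 < t < 1 -> (g y <= a%:E)%E -> (g z <= b%:E)%E ->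
    (g (t *: y + (1 - t) *: z)%R <= (t * a + (1 - t) * b)%R%:E)%E) ->
  convex_ereal g.
Proof.
move=> gN gc y z t tt; have /andP[t0 t1] := tt.
have t1' : 0 < 1 - t by rewrite subr_gt0.
have := gN y; have := gN z.
case Ez : (g z) => [b| |] // _; case Ey : (g y) => [a| |] // _.
- by rewrite -!EFinM -EFinD; apply: gc; rewrite ?Ez ?Ey.
- by rewrite gt0_muley ?lte_fin// -EFinM leey.
- by rewrite gt0_muley ?lte_fin// -EFinM leey.
- by rewrite !gt0_muley ?lte_fin// leey.
Qed.

(* Convexity at the point of [x0, y] at distance e / 2 from x0, where g > c - 1,
   bounds the decrease of g between x0 and y. *)
Lemma Gamma0_growth g z : Gamma0 g ->
  exists a b, 0 <= a /\ forall y r, (g y <= r%:E)%E -> - a * `|z - y| - b <= r.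
Proof.
move=> [gp gl gc]; have [x0 [c gx0]] := proper_fun_fin gp.
have [e e0 ge] : exists2 e, 0 < e &
    forall y, `|x0 - y| < e -> ((c - 1)%R%:E < g y)%E.
  by apply: lsc_ball => //; rewrite gx0 lte_fin ltrBlDr ltrDl.
have key y r : (g y <= r%:E)%E -> c - 1 - 2 / e * `|x0 - y| <= r.
  move=> gyr; have [ye|ye] := ltP `|x0 - y| e.
    have := lt_le_trans (ge _ ye) gyr; rewrite lte_fin => /ltW; apply: le_trans.
    by rewrite lerBlDr lerDl mulr_ge0// divr_ge0// ltW.
  have d0 : 0 < `|x0 - y| by apply: lt_le_trans ye.
  pose t := e / 2 / `|x0 - y|.
  have t0 : 0 < t by rewrite !divr_gt0.
  have tE : t * `|x0 - y| = e / 2 by rewrite divfK// gt_eqF.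
  have t1 : t <= 1 by rewrite ler_pdivrMr// mul1r; lra.
  have t01 : 0 <= t <= 1 by rewrite (ltW t0).
  have gx0' : (g x0 <= c%:E)%E by rewrite gx0.
  have h := convex_ereal_le gc t01 gyr gx0'.
  have : `|x0 - (t *: y + (1 - t) *: x0)| < e.
    rewrite (_ : _ - _ = t *: (x0 - y)); last first.
      rewrite scalerBl scale1r scalerBr opprD opprB.
    by rewrite [LHS]addrA [LHS]addrC [LHS]addrA subrK.
    by rewrite normrZ gtr0_norm// tE; lra.
  move=> /ge /lt_le_trans /(_ h); rewrite lte_fin => h'.
  have : t * (c - 1 - 2 / e * `|x0 - y|) <= t * r.
    have -> : t * (c - 1 - 2 / e * `|x0 - y|) = t * (c - 1) - 1.
      by rewrite mulrBr mulrCA tE; field; rewrite gt_eqF.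
    lra.
  by rewrite ler_pM2l.
(* The offset absorbs the change of center from x0 to z in the triangle inequality. *)
exists (2 / e), (1 - c + 2 / e * `|x0 - z|); split; first by rewrite divr_ge0// ltW.
move=> y r /key; apply: le_trans.
have : 2 / e * `|x0 - y| <= 2 / e * (`|x0 - z| + `|z - y|).
  rewrite ler_pM2l ?divr_gt0//; apply: le_trans (ler_normD _ _).
  by rewrite addrA subrK.
lra.
Qed.

Lemma Gamma0_scale g c : 0 < c -> Gamma0 g -> Gamma0 (fun y => c%:E * g y)%E.
Proof.
move=> c0 [[gN [w gw]] gl gc].
have ci : 0 < c^-1 by rewrite invr_gt0.
have le_scale y r : (c%:E * g y <= r%:E)%E -> (g y <= (c^-1 * r)%R%:E)%E.
  move=> h; have : (c^-1%:E * (c%:E * g y) <= c^-1%:E * r%:E)%E.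
    by apply: lee_wpmul2l => //; rewrite lee_fin ltW.
  by rewrite muleA -!EFinM mulVf ?gt_eqF// mul1e.
have N y : (c%:E * g y)%E != -oo%E.
  by move: (gN y); case: (g y) => [a| |] // _; rewrite gt0_muley// lte_fin.
split.
- split => //; exists w; move: gw; rewrite /edom /=; move: (gN w).
  by case: (g w) => [a| |] // _ _; rewrite -EFinM ltry.
- apply: ball_lsc => y a; rewrite ltNge => ay.
  have : ((c^-1 * a)%R%:E < g y)%E.
    rewrite ltNge; apply: contra ay => ay.
    have : (c%:E * g y <= c%:E * (c^-1 * a)%R%:E)%E.
      by apply: lee_wpmul2l; first by rewrite lee_fin ltW.
    by rewrite -EFinM mulVKf// gt_eqF.
  move=> /(lsc_ball gl)[e e0 ge]; exists e => // y' /ge; rewrite !ltNge.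
  by apply: contra => /le_scale.
- apply: le_convex_ereal => // y z t a b /andP[t0 t1] /le_scale ya /le_scale zb.
  have : (c%:E * g (t *: y + (1 - t) *: z)%R <=
          c%:E * (t * (c^-1 * a) + (1 - t) * (c^-1 * b))%R%:E)%E.
    apply: lee_wpmul2l; first by rewrite lee_fin ltW.
    by apply: convex_ereal_le => //; rewrite !ltW.
  rewrite -EFinM (_ : c * _ = t * a + (1 - t) * b)//.
  by field; rewrite gt_eqF.
Qed.

End ConvexFunctions.

(** * Subgradients and the proximity operator *)

(** The value at p must be finite, and the inequality is tested on real upper bounds r of g y, so
    that points of value +oo impose nothing. *)
Definition subgradient (R : realType) (V : normedModType R) (ip : V -> V -> R)
    (g : V -> \bar R) (p u : V) :=
  exists2 a, g p = a%:E & forall y r, (g y <= r%:E)%E -> a + ip (y - p) u <= r.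

Section Prox.
Context {R : realType} {V : normedModType R} {ip : V -> V -> R}.
Hypothesis ipP : inner_product ip.
Implicit Types (g : V -> \bar R) (y z p u : V) (a b r t : R).

Lemma subgradient_monotone g p u p' u' :
  subgradient ip g p u -> subgradient ip g p' u' -> 0 <= ip (p - p') (u - u').
Proof.
move=> [a gp pu] [b gp' pu'].
have := pu p' b; have := pu' p a; rewrite gp gp' => /(_ (lexx _)) h1 /(_ (lexx _)).
by move: h1; rewrite !(ipE ipP) => h1 h2; lra.
Qed.

Lemma subgradient_scale g p u c : 0 < c ->
  subgradient ip g p u -> subgradient ip (fun y => c%:E * g y)%E p (c *: u).
Proof.
move=> c0 [a gp pu]; exists (c * a); first by rewrite gp.
move=> y r h; have : (c^-1%:E * (c%:E * g y) <= c^-1%:E * r%:E)%E.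
  by apply: lee_wpmul2l => //; rewrite lee_fin invr_ge0 ltW.
rewrite muleA -!EFinM mulVf ?gt_eqF// mul1e => /pu.
by rewrite (ipZr ipP) -mulrDr ler_pdivlMl.
Qed.

(** The subgradient inequality gives every y an excess of |y - p|^2 / 2 over the value at p, hence
    both minimality and uniqueness. *)
Lemma prox_eq g z p : subgradient ip g p (z - p) -> prox g z = p.
Proof.
move=> [a gp pu].
have key y r : (g y <= r%:E)%E ->
    a + 2^-1 * `|z - p| ^+ 2 + 2^-1 * `|y - p| ^+ 2 <= r + 2^-1 * `|z - y| ^+ 2.
  move=> /pu; rewrite !(norm2_ip ipP) !(ipE ipP).
  rewrite (ipC ipP y p) (ipC ipP y z) (ipC ipP p z); lra.
apply: xget_unique => [y|q].
  (* A value -oo at y would contradict [key] for a small enough real r. *)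
  case E : (g y) => [b| |]; last 1 first.
  - have := key y (a + 2^-1 * `|z - p| ^+ 2 - 2^-1 * `|z - y| ^+ 2 - 1).
    rewrite E leNye => /(_ isT) h; exfalso; have := sqr_ge0 `|y - p|; lra.
  - rewrite gp -!EFinD lee_fin; have := key y b; rewrite E => /(_ (lexx _)).
    have := sqr_ge0 `|y - p|; lra.
  - by rewrite leey.
move=> /(_ p); rewrite gp; case E : (g q) => [b| |] //=; last 1 first.
  have := key q (a + 2^-1 * `|z - p| ^+ 2 - 2^-1 * `|z - q| ^+ 2 - 1).
  rewrite E leNye => /(_ isT) h; exfalso; have := sqr_ge0 `|q - p|; lra.
rewrite -!EFinD lee_fin => h; have := key q b; rewrite E => /(_ (lexx _)) h'.
apply/eqP; rewrite -subr_eq0; apply/eqP; apply: (ip_eq0 ipP).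
by rewrite -(norm2_ip ipP); lra.
Qed.

Lemma prox_scale_eq g c z p : 0 < c -> subgradient ip g p (c^-1 *: (z - p)) ->
  prox (fun y => c%:E * g y)%E z = p.
Proof.
move=> c0 /(subgradient_scale c0); rewrite scalerA divff ?gt_eqF// scale1r.
exact: prox_eq.
Qed.

End Prox.

Section ProxExists.
Context {R : realType} {V : completeNormedModType R} {ip : V -> V -> R}.
Hypothesis ipP : inner_product ip.
Implicit Types (g : V -> \bar R) (y z p u : V) (a b r t : R).

(* The sublevel sets of g + |z - .|^2 / 2 near its infimum form a Cauchy filter
   by strong convexity. *)
Lemma prox_minimizer g z : Gamma0 g -> exists p a, g p = a%:E /\
  forall y r, (g y <= r%:E)%E ->
    a + 2^-1 * `|z - p| ^+ 2 <= r + 2^-1 * `|z - y| ^+ 2.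
Proof.
move=> Gg; have [gp gl gc] := Gg; have [A [B [A0 gAB]]] := Gamma0_growth z Gg.
pose T := [set r | exists y a, (g y <= a%:E)%E /\ r = a + 2^-1 * `|z - y| ^+ 2].
have hT : has_inf T.
  split.
    have [y [a ya]] := proper_fun_fin gp.
    by exists (a + 2^-1 * `|z - y| ^+ 2), y, a; rewrite ya.
  (* This is the minimum over d of d^2 / 2 - A d - B. *)
  exists (- 2^-1 * A ^+ 2 - B) => _ [y [a [/gAB h ->]]].
  have := sqr_ge0 (`|z - y| - A); rewrite sqrrB; move: h.
  by rewrite -mulr_natr => h1 h2; nra.
pose m := inf T.
have mT y a : (g y <= a%:E)%E -> m <= a + 2^-1 * `|z - y| ^+ 2.
  by move=> ya; apply: ge_inf; [exact: hT.2 | exists y, a].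
pose L e := [set y | exists2 a, (g y <= a%:E)%E & a + 2^-1 * `|z - y| ^+ 2 < m + e].
pose F := filter_from [set e : R | 0 < e] L.
have Lne e : 0 < e -> L e !=set0.
  by move=> e0; have [_ [y [a [ya ->]]] h] := inf_adherent e0 hT; exists y, a.
have FF : ProperFilter F.
  apply: filter_from_proper; last exact: Lne.
  apply: filter_from_filter; first by exists 1 => /=.
  move=> e e' /= e0 e0'; exists (Num.min e e') => /=; first by rewrite lt_min e0.
  move=> y [a ya h]; split; exists a => //; apply: lt_le_trans h _;
    by rewrite lerD2l ge_min lexx ?orbT.
(* The midpoint of y and y' has value at least m, while convexity and the parallelogram law put it
   |y - y'|^2 / 8 below the mean of the two values. *)
have Ldist e y y' : L e y -> L e y' -> `|y - y'| ^+ 2 <= 8 * e.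
  move=> [a ya ha] [a' ya' ha'].
  have h01 : 0 <= (2^-1 : R) <= 1 by apply/andP; split; lra.
  have := mT _ _ (convex_ereal_le gc h01 ya ya').
  move: ha ha'; rewrite !(norm2_ip ipP) !(ipE ipP).
  rewrite (ipC ipP y z) (ipC ipP y' z) (ipC ipP y' y); lra.
have Fc : cauchy F.
  apply: cauchy_exP => e e0; have d0 : 0 < e ^+ 2 / 9 by rewrite divr_gt0 ?exprn_gt0.
  have [y Ly] := Lne _ d0; exists y; exists (e ^+ 2 / 9) => //= y' Ly'.
  rewrite -ball_normE /=; have := Ldist _ _ _ Ly Ly'.
  move=> h.
  suff : `|y - y'| ^+ 2 < e ^+ 2 by rewrite ltr_sqr ?nnegrE ?(ltW e0).
  apply: le_lt_trans h _.
  have := exprn_gt0 2 e0; lra.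
have /cvg_ex[p Fp] : cvg F by exact: cauchy_cvg.
have near e : 0 < e -> exists2 y, L e y & `|p - y| < e.
  move=> e0; have : F (L e) by exists e.
  move=> h2; have h1 := Fp _ (nbhsx_ballx p e e0); rewrite -ball_normE in h1.
  by have [y [h3 h4]] := filter_ex (filterI h1 h2); exists y.
have gpm e : 0 < e -> (g p <= (m + e - 2^-1 * `|z - p| ^+ 2)%R%:E)%E.
  move=> e0; rewrite leNgt; apply/negP => /(lsc_ball gl)[d d0 gd].
  pose K := `|z - p| + 1; have K0 : 0 < K by rewrite ltr_wpDl.
  (* A point y within s of p satisfies the lower bound on g, misses the infimum by at most e / 2,
     and lowers |z - .|^2 / 2 by at most e / 2 from its value at p. *)
  pose s := Num.min d (Num.min (e / 2) (e / 2 / K)).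
  have s0 : 0 < s by rewrite !lt_min d0 !divr_gt0.
  have [y [a ya ha] py] := near _ s0.
  have := gd y; rewrite (lt_le_trans py) ?ge_min ?lexx// => /(_ isT).
  move=> /lt_le_trans /(_ ya); rewrite lte_fin => h.
  have h1 : `|p - y| * K <= e / 2.
    rewrite -ler_pdivlMr//; apply: ltW; apply: lt_le_trans py _.
    by rewrite !ge_min lexx !orbT.
  have h2 : s <= e / 2 by rewrite !ge_min lexx !orbT.
  have h3 : `|z - p| ^+ 2 <= `|z - y| ^+ 2 + 2 * (`|z - p| * `|p - y|).
    have := ip_le ipP (z - p) (y - p); rewrite (distrC y p).
    have := ip_ge0 ipP (y - p); rewrite !(norm2_ip ipP) !(ipE ipP).
    rewrite (ipC ipP y z) (ipC ipP p z) (ipC ipP y p); lra.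
  have := normr_ge0 (p - y); rewrite /K in h1; lra.
have [a gpa _] := Gamma0_le_fin Gg (gpm 1 ltr01).
exists p, a; split => // y r /mT; apply: le_trans.
apply/ler_addgt0Pr => e /gpm; rewrite gpa lee_fin; lra.
Qed.

(** First-order condition: the minimizer p is compared with t y + (1 - t) p, the inequality is
    divided by t, and t is taken so small that the quadratic term t |y - p|^2 is at most e. *)
Lemma prox_subgradient g z : Gamma0 g -> subgradient ip g (prox g z) (z - prox g z).
Proof.
move=> Gg; have [p [a [gp pm]]] := prox_minimizer z Gg.
suff h : subgradient ip g p (z - p) by rewrite (prox_eq ipP h).
have [_ _ gc] := Gg.
exists a => // y r yr; apply/ler_addgt0Pr => e e0.
pose K := `|y - p| ^+ 2 + 1; have K0 : 0 < K by rewrite ltr_wpDl ?sqr_ge0.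
pose t := Num.min 1 (e / K).
have t0 : 0 < t by rewrite lt_min ltr01 divr_gt0.
have t01 : 0 <= t <= 1 by rewrite ltW// ge_min lexx.
have tK : t * `|y - p| ^+ 2 <= e.
  have : t <= e / K by rewrite ge_min lexx orbT.
  rewrite ler_pdivlMr// /K; nra.
have ga : (g p <= a%:E)%E by rewrite gp.
rewrite -(ler_pM2l t0); have := pm _ _ (convex_ereal_le gc t01 yr ga).
have : t * (t * `|y - p| ^+ 2) <= t * e by rewrite ler_pM2l.
rewrite !(norm2_ip ipP) !(ipE ipP).
rewrite (ipC ipP y z) (ipC ipP y p) (ipC ipP p z).
have := mulr_gt0 t0 e0; lra.
Qed.

Lemma prox_scale_subgradient g c z (p := prox (fun y => c%:E * g y)%E z) :
  0 < c -> Gamma0 g -> subgradient ip g p (c^-1 *: (z - p)).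
Proof.
move=> c0 Gg; have := prox_subgradient z (Gamma0_scale c0 Gg); rewrite -/p.
have c0' : 0 < c^-1 by rewrite invr_gt0.
move=> /(subgradient_scale ipP c0'); congr subgradient.
by apply/funext => y; rewrite muleA -EFinM mulVf ?gt_eqF// mul1e.
Qed.

End ProxExists.

(** * Closures, domains and epigraphs as convex sets *)

Definition set_convex (R : realType) (V : normedModType R) (C : set V) :=
  forall (y z : V) (t : R), 0 <= t <= 1 -> C y -> C z ->
    C (t *: y + (1 - t) *: z).

Section Closure.
Context {R : realType} {V : normedModType R}.
Implicit Types (E C : set V) (g : V -> \bar R).

Lemma closure_normP E y :
  closure E y <-> forall e : R, 0 < e -> exists2 y', E y' & `|y - y'| < e.
Proof.
split=> [Ey e e0|Ey B /nbhs_normP[e /= e0 eB]].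
  have [|y' [Ey' yy']] := Ey (ball_ Num.norm y e); last by exists y'.
  by apply/nbhs_normP; exists e.
by have [y' Ey' yy'] := Ey e e0; exists y'; split => //; apply: eB.
Qed.

End Closure.

Section Gamma0Sets.
Context {R : realType} {V : normedModType R}.
Implicit Types (E : set V) (g : V -> \bar R).

Lemma set_convex_closure E : set_convex E -> set_convex (closure E).
Proof.
move=> Ec y z t t01 /closure_normP Ey /closure_normP Ez; apply/closure_normP.
move=> e e0; have [y' Ey' yy'] := Ey e e0; have [z' Ez' zz'] := Ez e e0.
exists (t *: y' + (1 - t) *: z'); first exact: Ec.
rewrite opprD addrACA -!scalerBr; apply: le_lt_trans (ler_normD _ _) _.
have /andP[t0 t1] := t01.
rewrite !normrZ (ger0_norm t0) ger0_norm ?subr_ge0//.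
have : Num.max `|y - y'| `|z - z'| < e by rewrite gt_max yy'.
have : `|y - y'| <= Num.max `|y - y'| `|z - z'| by rewrite le_max lexx.
have : `|z - z'| <= Num.max `|y - y'| `|z - z'| by rewrite le_max lexx orbT.
set m := Num.max _ _; move=> h1 h2; apply: le_lt_trans.
have := ler_wpM2l t0 h2.
have : (1 - t) * `|z - z'| <= (1 - t) * m by rewrite ler_wpM2l ?subr_ge0.
lra.
Qed.

Lemma set_convex_edom g : convex_ereal g -> (forall y, g y != -oo%E) ->
  set_convex (edom g).
Proof.
move=> gc gN y z t t01; rewrite /edom /=.
move: (gN y) (gN z); case Ey : (g y) => [a| |] //; case Ez : (g z) => [b| |] //.
move=> _ _ _ _; apply: le_lt_trans (ltry (t * a + (1 - t) * b)).
by apply: convex_ereal_le; rewrite ?Ey ?Ez.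
Qed.

Lemma edomP g y : Gamma0 g -> edom g y <-> exists a, g y = a%:E.
Proof.
move=> [[gN _] _ _]; rewrite /edom /=; move: (gN y).
case: (g y) => [a| |] // _; first by split=> _; [exists a | rewrite ltry].
by split=> // -[].
Qed.

Lemma Gamma0_edom g : Gamma0 g -> edom g !=set0.
Proof. by case=> -[]. Qed.

Lemma Gamma0_convex_edom g : Gamma0 g -> set_convex (edom g).
Proof. by move=> [[gN _] _ gc]; exact: set_convex_edom. Qed.

Lemma Gamma0_closed_epi g : Gamma0 g -> closed (epi g).
Proof.
move=> [gp gl gc] z zE; have {}zE := (closure_normP _ _).1 zE.
rewrite /epi /= leNgt.
apply/negP => zg.
have [a za ag] : exists2 a : R, z.2 < a & (a%:E < g z.1)%E.
  case E : (g z.1) zg => [b| |] //=; rewrite ?lte_fin => zb.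
    by exists ((z.2 + b) / 2); rewrite ?lte_fin; lra.
  by exists (z.2 + 1); rewrite ?ltry// ltrDl.
have [d d0 gd] := lsc_ball gl ag.
have [|z' /= z'E zz'] := zE (Num.min d (a - z.2)).
  by rewrite lt_min d0 subr_gt0.
have h1 : `|z.1 - z'.1| < d.
  apply: le_lt_trans (hsum_norm1 (z - z')) _; apply: lt_le_trans zz' _.
  by rewrite ge_min lexx.
have h2 : `|z.2 - z'.2| < a - z.2.
  apply: le_lt_trans (hsum_norm2 (z - z')) _; apply: lt_le_trans zz' _.
  by rewrite ge_min lexx orbT.
have := lt_le_trans (gd _ h1) z'E; rewrite lte_fin.
move: h2; rewrite ltr_norml => /andP[]; lra.
Qed.

Lemma Gamma0_convex_epi g : Gamma0 g -> set_convex (epi g).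
Proof.
move=> [gp gl gc] y z t t01; rewrite /epi /= => gy gz.
exact: convex_ereal_le.
Qed.

Lemma Gamma0_epi g : Gamma0 g -> epi g !=set0.
Proof.
move=> [gp _ _]; have [y [a ya]] := proper_fun_fin gp.
by exists ((y, a) : hsum V R^o); rewrite /epi /= ya.
Qed.

End Gamma0Sets.

(** * Projection onto closed convex sets *)

Section Projection.
Context {R : realType} {V : normedModType R} {ip : V -> V -> R}.
Hypothesis ipP : inner_product ip.
Implicit Types (C E : set V) (y z p w : V).

(** By the obtuse angle condition |z - y|^2 exceeds |z - p|^2 by at least |y - p|^2, which gives
    minimality and uniqueness. *)
Lemma proj_eq C z p : C p -> (forall y, C y -> ip (y - p) (z - p) <= 0) ->
  proj_set C z = p.
Proof.
move=> Cp Cip.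
have key y : C y -> `|z - p| ^+ 2 + `|y - p| ^+ 2 <= `|z - y| ^+ 2.
  move=> /Cip; rewrite !(norm2_ip ipP) !(ipE ipP).
  rewrite (ipC ipP y p) (ipC ipP y z) (ipC ipP p z); lra.
apply: xget_unique => [|q [Cq qm]].
  split=> // y /key h; rewrite -ler_sqr ?nnegrE//; apply: le_trans h.
  by rewrite lerDl sqr_ge0.
apply/eqP; rewrite -subr_eq0; apply/eqP; apply: (ip_eq0 ipP).
rewrite -(norm2_ip ipP); have := key _ Cq; have := qm _ Cp.
by rewrite -ler_sqr ?nnegrE//; lra.
Qed.

Lemma ip_closure_le E w r : (forall y, E y -> ip y w <= r) ->
  forall y, closure E y -> ip y w <= r.
Proof.
move=> Ew y /closure_normP Ey; apply/ler_addgt0Pr => e e0.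
pose K := `|w| + 1; have K0 : 0 < K by rewrite ltr_wpDl.
have [|y' /Ew h yy'] := Ey (e / K); first by rewrite divr_gt0.
have := ip_le ipP (y - y') w.
have : `|y - y'| * K <= e by rewrite -ler_pdivlMr// ltW.
have := normr_ge0 (y - y'); move: h; rewrite !(ipE ipP) /K; lra.
Qed.

End Projection.

Section ProjectionExists.
Context {R : realType} {V : completeNormedModType R} {ip : V -> V -> R}.
Hypothesis ipP : inner_product ip.
Implicit Types (C E : set V) (y z p w : V) (g : V -> \bar R).

Let indicator C y : \bar R := if y \in C then 0%E else +oo%E.

Let indicator_le C y (r : R) : (indicator C y <= r%:E)%E -> C y /\ 0 <= r.
Proof. by rewrite /indicator; case: ifP => // /set_mem Cy; rewrite lee_fin. Qed.

Let indicator_Gamma0 C : closed C -> set_convex C -> C !=set0 ->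
  Gamma0 (indicator C).
Proof.
move=> Ccl Cc [w Cw].
have N y : indicator C y != -oo%E by rewrite /indicator; case: ifP.
split.
- by split=> //; exists w; rewrite /edom /indicator /= mem_set.
- apply: ball_lsc => y a; have [Cy|Cy] := pselect (C y).
    rewrite /indicator mem_set// lte_fin => a0; exists 1 => // y' _.
    by case: ifP => _; rewrite ?lte_fin// ltry.
  move=> _; have : ~ closure C y by move=> /Ccl.
  rewrite closure_normP => /existsNP[e /not_implyP[e0 he]].
  exists e => // y' yy'; rewrite /indicator memNset ?ltry//.
  by move=> Cy'; apply: he; exists y'.
- apply: le_convex_ereal => // y z t a b /andP[t0 t1].
  move=> /indicator_le[Cy a0] /indicator_le[Cz b0].
  rewrite /indicator mem_set ?lee_fin; last by apply: Cc => //; rewrite !ltW.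
  by rewrite addr_ge0// mulr_ge0// ?subr_ge0 ltW.
Qed.

(** The prox of the indicator function of C is the projection, and its subgradient inequality is the
    obtuse angle condition. *)
Lemma proj_spec C z : closed C -> set_convex C -> C !=set0 ->
  C (proj_set C z) /\
  forall y, C y -> ip (y - proj_set C z) (z - proj_set C z) <= 0.
Proof.
move=> Ccl Cc C0; have IC := indicator_Gamma0 Ccl Cc C0.
have [a pa pz] := prox_subgradient ipP z IC.
set p := prox _ z in pa pz *.
have [Cp a0] : C p /\ 0 <= a by apply: indicator_le; rewrite pa.
have h y : C y -> ip (y - p) (z - p) <= 0.
  move=> Cy; have := pz y 0; rewrite /indicator mem_set// => /(_ (lexx _)).
  lra.
by rewrite (proj_eq ipP Cp h).
Qed.

Lemma proj_closure_edom g z (p := proj_set (closure (edom g)) z) : Gamma0 g ->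
  closure (edom g) p /\ forall y, edom g y -> ip (y - p) (z - p) <= 0.
Proof.
move=> Gg; have [] := @proj_spec (closure (edom g)) z.
- exact: closed_closure.
- by apply: set_convex_closure; exact: Gamma0_convex_edom.
- by have [y gy] := Gamma0_edom Gg; exists y; apply: subset_closure.
- by move=> pE ph; split => // y gy; apply: ph; apply: subset_closure.
Qed.

Lemma proj_closure_edom_eq g z p : closure (edom g) p ->
  (forall y, edom g y -> ip (y - p) (z - p) <= 0) ->
  proj_set (closure (edom g)) z = p.
Proof.
move=> pE ph; apply: (proj_eq ipP) => // y Ey.
rewrite (ipDl ipP) (ipNl ipP) subr_le0.
apply: (ip_closure_le ipP) Ey => y' /ph.
by rewrite (ipDl ipP) (ipNl ipP) subr_le0.
Qed.

End ProjectionExists.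

(** * Projection onto an epigraph *)

Section EpigraphProjection.
Context {R : realType} {V : completeNormedModType R} {ip : V -> V -> R}.
Hypothesis ipP : inner_product ip.
Implicit Types (g : V -> \bar R).

Let proj_epi_spec g (w : hsum V R^o) (q := proj_set (epi g) w) : Gamma0 g ->
  epi g q /\ forall y, epi g y ->
    hsum_ip ip (fun a b : R^o => a * b) (y - q) (w - q) <= 0.
Proof.
move=> Gg; apply: (proj_spec (hsum_inner_product ipP (mul_inner_product R))).
- exact: Gamma0_closed_epi.
- exact: Gamma0_convex_epi.
- exact: Gamma0_epi.
Qed.

(** Raising a point of the epigraph stays inside it, so s is at least t. If s = t the normal is
    horizontal and p is a projection onto the closed domain; otherwise the normal divided by s - t
    is a subgradient. The lemma serves both [persp f] and the conjugate of [f]. *)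
Lemma epi_proj_cases g z (t : R) (p : V) (s : R) : Gamma0 g ->
  ((p, s) : hsum V R^o) = proj_set (epi g) (z, t) ->
  [/\ s = t, (g p <= t%:E)%E & p = proj_set (closure (edom g)) z] \/
  [/\ t < s, g p = s%:E & subgradient ip g p ((s - t)^-1 *: (z - p))].
Proof.
move=> Gg ps; have [] := proj_epi_spec (z, t) Gg; rewrite -ps.
rewrite {1}/epi /= => gp h.
have key y r : (g y <= r%:E)%E -> ip (y - p) (z - p) + (r - s) * (t - s) <= 0.
  by move=> gy; apply: (h ((y, r) : hsum V R^o)).
have ts : t <= s.
  have := key p (s + 1) (le_trans gp _); rewrite lee_fin lerDl => /(_ ler01).
  rewrite subrr (ip0l ipP); lra.
have [tE|tNs] := eqVneq t s.
  left; split; rewrite ?tE//; apply/esym/(proj_closure_edom_eq ipP).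
    by apply: subset_closure; apply: le_lt_trans gp (ltry _).
  move=> y /(edomP _ Gg)[a ya]; have := key y a; rewrite ya => /(_ (lexx _)).
  by rewrite tE subrr mulr0 addr0.
have tls : t < s by rewrite lt_neqAle tNs.
right; have [a pa pas] := Gamma0_le_fin Gg gp.
have as' : s <= a.
  have := key p a; rewrite pa => /(_ (lexx _)).
  rewrite subrr (ip0l ipP); nra.
have {}pa : g p = s%:E by rewrite pa; congr EFin; apply/eqP; rewrite eq_le pas.
split => //; exists s => // y r /key h'.
rewrite (ipZr ipP) -lerBrDl ler_pdivrMl ?subr_gt0//; lra.
Qed.

End EpigraphProjection.

(** * Conjugates and the Fenchel-Moreau theorem *)

Section AffineSup.
Context {R : realType} {V : normedModType R} {ip : V -> V -> R}.
Hypothesis ipP : inner_product ip.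
Implicit Types (g : V -> \bar R) (y u : V) (a r : R).

(** The first hypothesis makes g the supremum of the affine functions indexed by S. A member of S
    excludes the value -oo, and the last hypothesis provides a point of the domain. *)
Lemma affine_sup_Gamma0 g (S : set (V * R)) :
  (forall y r, (g y <= r%:E)%E <-> forall u a, S (u, a) -> ip y u - a <= r) ->
  S !=set0 -> (exists y r, (g y <= r%:E)%E) -> Gamma0 g.
Proof.
move=> gS [[u0 a0] S0] [w [b wb]].
have N y : g y != -oo%E.
  apply/eqP => gy; have [h _] := gS y (ip y u0 - a0 - 1).
  by move: h; rewrite gy leNye => /(_ isT _ _ S0); lra.
split.
- by split=> //; exists w; apply: le_lt_trans wb (ltry _).
- apply: ball_lsc => y a; rewrite ltNge => /negP/gS.
  move=> /existsNP[u /existsNP[c /not_implyP[Suc /negP]]]; rewrite -ltNge => h.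
  pose K := `|u| + 1; have K0 : 0 < K by rewrite ltr_wpDl.
  exists ((ip y u - c - a) / K); first by rewrite divr_gt0// subr_gt0.
  move=> y'; rewrite ltr_pdivlMr// => yy'; rewrite ltNge; apply/negP.
  move=> /gS /(_ _ _ Suc) h'; have := ip_le ipP (y - y') u.
  have := normr_ge0 (y - y'); move: yy'; rewrite !(ipE ipP) /K; lra.
- apply: le_convex_ereal => // y z t a c /andP[t0 t1] /gS ya /gS zb.
  apply/gS => u d Suc; have h1 := ya _ _ Suc; have h2 := zb _ _ Suc.
  rewrite !(ipE ipP); nra.
Qed.

Lemma fenchel_conj_le g u r : (fenchel_conj ip g u <= r%:E)%E <->
  forall y a, (g y <= a%:E)%E -> ip y u - a <= r.
Proof.
split=> [h y a ya|h].
  have : ((ip y u)%:E - g y <= r%:E)%E.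
    by apply: le_trans h; apply: ereal_sup_ubound; exists y.
  move: ya; case: (g y) => [b| |] //=; rewrite ?lee_fin; lra.
apply: ge_ereal_sup => _ [y _ <-]; have := h y.
case: (g y) => [b| |] h'; rewrite ?leNye//.
  by rewrite -EFinB lee_fin; apply: h'.
by have := h' (ip y u - r - 1); rewrite leNye => /(_ isT) h2; exfalso; lra.
Qed.

(** Equality case of Fenchel-Young: the supremum defining the conjugate is attained at p. *)
Lemma subgradient_fenchel_conj_val g p u : subgradient ip g p u ->
  exists2 a, g p = a%:E & fenchel_conj ip g u = (ip p u - a)%R%:E.
Proof.
move=> [a pa pu]; exists a => //; apply/eqP; rewrite eq_le; apply/andP; split.
  by apply/fenchel_conj_le => y b /pu; rewrite !(ipE ipP); lra.
rewrite EFinB -pa; apply: ereal_sup_ubound; by exists p.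
Qed.

End AffineSup.

Section FenchelMoreau.
Context {R : realType} {V : completeNormedModType R} {ip : V -> V -> R}.
Hypothesis ipP : inner_product ip.
Implicit Types (f : V -> \bar R) (y p u : V) (a r t : R).

(* The affine minorants come from the subgradients at prox_{t f} y: as t -> 0
   these points stay where f > a, or the gain |y - p|^2 / t blows up. *)
Lemma fenchel_moreau f y a : Gamma0 f -> (a%:E < f y)%E ->
  exists u r, (fenchel_conj ip f u <= r%:E)%E /\ a < ip y u - r.
Proof.
move=> Gf ay; have [fp fl fc] := Gf; have [e e0 fe] := lsc_ball fl ay.
have [A [B [A0 fAB]]] := Gamma0_growth y Gf.
pose C := `|a| + `|B| + 1; have C0 : 0 < C by rewrite ltr_wpDl// addr_ge0.
(* With t = e^2 / D both 4 t C <= e^2 and 2 t A <= e hold, which makes d^2 <= t (C + A d) impossible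
   for d >= e. *)
pose D := 4 * C + 2 * (A * e).
have D0 : 0 < D by rewrite ltr_wpDr ?mulr_ge0 ?mulr_gt0// ltW.
pose t := e ^+ 2 / D; have t0 : 0 < t by rewrite divr_gt0 ?exprn_gt0.
have tD : t * D = e ^+ 2 by rewrite divfK// gt_eqF.
pose p := prox (fun w => t%:E * f w)%E y.
have pu : subgradient ip f p (t^-1 *: (y - p)) := prox_scale_subgradient ipP y t0 Gf.
set u := _ *: _ in pu; have [b pb ub] := subgradient_fenchel_conj_val ipP pu.
exists u, (ip p u - b); split; first by rewrite ub.
have -> : ip y u - (ip p u - b) = t^-1 * `|y - p| ^+ 2 + b.
  by rewrite (norm2_ip ipP) -(ipZr ipP) -/u !(ipE ipP); lra.
rewrite ltNge; apply/negP => h.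
have [ype|epy] := ltP `|y - p| e.
  have := fe _ ype; rewrite pb lte_fin.
  have : 0 <= t^-1 * `|y - p| ^+ 2 by rewrite mulr_ge0 ?sqr_ge0// invr_ge0 ltW.
  lra.
have := fAB p b; rewrite pb => /(_ (lexx _)); set d := `|y - p| in h epy *.
move=> hb; have hC : a + B <= C.
  rewrite /C; have := ler_norm a; have := ler_norm B; lra.
have h1 : t^-1 * d ^+ 2 <= C + A * d by lra.
have {h1} : d ^+ 2 <= t * (C + A * d) by rewrite -ler_pdivrMl.
have d0 : 0 < d by apply: lt_le_trans epy.
have tC : 4 * (t * C) <= e ^+ 2.
  have : 0 <= t * (A * e).
    by apply: mulr_ge0; [exact: ltW | apply: mulr_ge0 => //; exact: ltW].
  by rewrite -tD /D; lra.
have tA : 2 * (t * A) <= e.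
  rewrite -(ler_pM2r e0) -expr2 -tD /D.
  have : 0 <= t * C by rewrite mulr_ge0 ?(ltW t0) ?(ltW C0).
  lra.
have : 2 * (t * A) * d <= e * d by rewrite ler_pM2r.
have : e * d <= d * d by rewrite ler_pM2r.
have : e ^+ 2 <= d ^+ 2 by rewrite ler_sqr ?nnegrE ?(ltW e0) ?(ltW d0).
have := exprn_gt0 2 d0; rewrite expr2; lra.
Qed.

Lemma fenchel_moreau_le f y r : Gamma0 f -> (f y <= r%:E)%E <->
  forall u a, (fenchel_conj ip f u <= a%:E)%E -> ip y u - a <= r.
Proof.
move=> Gf; split=> [yr u a /fenchel_conj_le /(_ _ _ yr)|h]; first lra.
rewrite leNgt; apply/negP => /(fenchel_moreau Gf)[u [a [/h]]]; lra.
Qed.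

(** The conjugate is a supremum of affine functions indexed by the epigraph of f; an affine minorant
    of f, from [fenchel_moreau], is a point of its domain. *)
Lemma fenchel_conj_Gamma0 f : Gamma0 f -> Gamma0 (fenchel_conj ip f).
Proof.
move=> Gf; have [fp _ _] := Gf; have [y [a ya]] := proper_fun_fin fp.
apply: (affine_sup_Gamma0 ipP (S := [set w | (f w.1 <= w.2%:E)%E])).
- move=> u r; rewrite fenchel_conj_le /=.
  by split=> h z b; [rewrite (ipC ipP)|rewrite (ipC ipP z)] => /h.
- by exists (y, a); rewrite /= ya.
- have [|u [r [ur _]]] := @fenchel_moreau f y (a - 1) Gf; last by exists u, r.
  by rewrite ya lte_fin ltrBlDr ltrDl.
Qed.

(** Biconjugation turns the subgradient inequality of the conjugate into f p <= <p, u> - b, the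
    reverse of Fenchel-Young. *)
Lemma fenchel_conj_subgradient f p u : Gamma0 f ->
  subgradient ip (fenchel_conj ip f) u p -> subgradient ip f p u.
Proof.
move=> Gf [b ub up].
have pb : (f p <= (ip p u - b)%R%:E)%E.
  apply/(fenchel_moreau_le _ _ Gf) => v r /up.
  by rewrite !(ipE ipP) (ipC ipP v p) (ipC ipP u p); lra.
have /fenchel_conj_le fen : (fenchel_conj ip f u <= b%:E)%E by rewrite ub.
have [a pa ab] := Gamma0_le_fin Gf pb.
exists a => // y r /fen; have := fen p a; rewrite pa => /(_ (lexx _)).
rewrite !(ipE ipP); lra.
Qed.

End FenchelMoreau.

(** * Recession function and perspective as support functions *)

Lemma cvg_le_pinfty (R : realType) (h : R -> \bar R) (S : \bar R) :
  S != -oo%E -> (forall t, 0 < t -> (h t <= S)%E) ->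
  (forall a : R, (a%:E < S)%E -> exists M, forall t, M < t -> (a%:E < h t)%E) ->
  h t @[t --> +oo] --> S.
Proof.
case: S => [s| |] // _ hS hlt.
  move=> B [e /= e0 eB]; have [|M hM] := hlt (s - e).
    by rewrite lte_fin ltrBlDr ltrDl.
  exists (Num.max M 0); split; first exact: num_real.
  move=> t; rewrite gt_max => /andP[Mt t0]; have := hM _ Mt; have := hS _ t0.
  case E : (h t) => [b| |] //; rewrite lee_fin lte_fin => bs sb.
  by rewrite /= E; apply: eB; rewrite /= ger0_norm; lra.
apply/cvgeyPgt => a; have [M hM] := hlt a (ltry a).
by exists M; split => //; exact: num_real.
Qed.

Section Recession.
Context {R : realType} {V : completeNormedModType R} {ip : V -> V -> R}.
Hypothesis ipP : inner_product ip.
Variable f : V -> \bar R.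
Hypothesis Gf : Gamma0 f.
Implicit Types (y u : V) (a r t : R).

Local Notation fc := (fenchel_conj ip f).

(** Along y each affine minorant of f gains at most t S, so f does too by biconjugation. Conversely
    each u in the domain of the conjugate gives a minorant of slope <y, u>. *)
Lemma recession_support y :
  recession f y = ereal_sup [set (ip y u)%:E | u in edom fc].
Proof.
have Gfc := fenchel_conj_Gamma0 ipP Gf.
set S := ereal_sup _; apply/cvg_lim => //; set x0 := xget _ _.
have [c xc] : exists c, f x0 = c%:E.
  apply/(edomP _ Gf); have [w fw] := Gamma0_edom Gf.
  exact: (@xgetPex _ 0 (edom f) (ex_intro _ w fw)).
have ubS u : edom fc u -> ((ip y u)%:E <= S)%E.
  by move=> ud; apply: ereal_sup_ubound; exists u.
have [u0 ud0] := Gamma0_edom Gfc.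
have SN : S != -oo%E.
  by apply/eqP => SE; have := ubS _ ud0; rewrite SE.
apply: cvg_le_pinfty => // [t t0|a aS].
  case SE : S SN ubS => [s| |] // _ ubS; last by rewrite leey.
  have : (f (x0 + t *: y)%R <= (c + t * s)%R%:E)%E.
    apply/(fenchel_moreau_le ipP _ _ Gf) => u a ua.
    have /ubS : edom fc u by apply: le_lt_trans ua (ltry _).
    rewrite lee_fin => /(ler_wpM2l (ltW t0)) us.
    have /fenchel_conj_le /(_ x0 c) := ua; rewrite xc => /(_ (lexx _)).
    by move: us; rewrite !(ipE ipP); lra.
  rewrite xc; move=> h; rewrite -lee_pdivlMl// ?invr_gt0// invrK.
  by rewrite leeBlDr// -EFinM -EFinD [(t * s + c)%R]addrC.
have [_ [u ud <-] au] := ereal_sup_gt aS.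
have [b ub] := (edomP _ Gfc).1 ud.
rewrite lte_fin in au.
(* Beyond K the excess of slope t (<y, u> - a) outweighs the difference of the intercepts. *)
pose K := `|ip x0 u - b - c| / (ip y u - a).
exists K => t Kt; have t0 : 0 < t.
  by apply: le_lt_trans Kt; rewrite divr_ge0// subr_ge0 ltW.
have h : (((ip x0 u + t * ip y u) - b)%R%:E <= f (x0 + t *: y)%R)%E.
  have [[fN _] _ _] := Gf; move: (fN (x0 + t *: y)%R).
  case E : (f (x0 + t *: y)%R) => [d| |] // _; last by rewrite leey.
  have /fenchel_conj_le h : (fc u <= b%:E)%E by rewrite ub.
  have := h (x0 + t *: y)%R d; rewrite E => /(_ (lexx _)).
  by rewrite lee_fin !(ipE ipP); lra.
rewrite xc -lte_pdivrMl// ?invr_gt0// invrK lteBrDr// -EFinM -EFinD.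
apply: lt_le_trans h; rewrite lte_fin.
have : `|ip x0 u - b - c| < t * (ip y u - a).
  by rewrite -ltr_pdivrMr// subr_gt0.
by rewrite ltr_norml => /andP[]; lra.
Qed.

Lemma recession_le y r : (recession f y <= r%:E)%E <->
  forall u, edom fc u -> ip y u <= r.
Proof.
rewrite recession_support; split=> [h u ud|h].
  by rewrite -lee_fin; apply: le_trans h; apply: ereal_sup_ubound; exists u.
by apply: ge_ereal_sup => _ [u ud <-]; rewrite lee_fin; apply: h.
Qed.

Lemma recession_neqNy y : recession f y != -oo%E.
Proof.
have [u ud] := Gamma0_edom (fenchel_conj_Gamma0 ipP Gf).
apply/eqP => yE; have [h _] := recession_le y (ip y u - 1).
by have := h _ u ud; rewrite yE leNye => /(_ isT); lra.
Qed.

Let recession_le_closure y r u : (recession f y <= r%:E)%E ->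
  closure (edom fc) u -> ip y u <= r.
Proof.
move=> /recession_le h ucl; rewrite (ipC ipP).
by apply: (ip_closure_le ipP) ucl => v; rewrite (ipC ipP); exact: h.
Qed.

(** Only membership in the closure is asked of u because the first branch of the loop projects onto
    the closed domain of the conjugate. *)
Lemma recession_max y u : closure (edom fc) u ->
  (forall v, edom fc v -> ip y v <= ip y u) -> recession f y = (ip y u)%:E.
Proof.
move=> ucl ymax.
have yu : (recession f y <= (ip y u)%:E)%E by apply/recession_le.
move: (recession_neqNy y) yu (@recession_le_closure y ^~ u).
case: (recession f y) => [a| |] // _.
rewrite lee_fin => au /(_ a (lexx _) ucl) ua.
by congr EFin; apply/eqP; rewrite eq_le au.
Qed.

Lemma recession_subgradient y u : closure (edom fc) u ->
  (forall v, edom fc v -> ip y v <= ip y u) -> subgradient ip (recession f) y u.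
Proof.
move=> ucl ymax; exists (ip y u); first exact: recession_max.
move=> y' r /recession_le_closure /(_ ucl); rewrite !(ipE ipP); lra.
Qed.

Local Notation hip := (hsum_ip ip (fun a b : R^o => a * b : R)).

(** This makes the perspective the support function of the reflected epigraph of the conjugate. For
    e > 0 it is biconjugation scaled by e, for e = 0 it is [recession_le], and for e < 0 the set is
    unbounded downwards, so the supremum is +oo. *)
Lemma persp_le (w : hsum V R^o) r : (persp f w <= r%:E)%E <->
  forall c : hsum V R^o, (fc c.1 <= (- c.2 : R)%:E)%E -> hip w c <= r.
Proof.
have Gfc := fenchel_conj_Gamma0 ipP Gf.
case: w => y e; rewrite /persp /hsum_ip /=; case: ltP => [e0|e0].
  rewrite -lee_pdivlMl// -EFinM (fenchel_moreau_le ipP _ _ Gf).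
  split=> [h [u b] /= /h|h u a ua].
    rewrite !(ipE ipP) opprK -(ler_pM2l e0) mulrDr !mulrA divff ?gt_eqF//.
    by rewrite !mul1r.
  have := h (u, - a); rewrite /= opprK => /(_ ua) h1.
  rewrite -(ler_pM2l e0) !(ipE ipP) mulrBr !mulrA divff ?gt_eqF//.
  by rewrite !mul1r; move: h1; rewrite mulrN.
case: eqP => [->|eN].
  rewrite recession_le; split=> [h [u b] /= ub|h u /(edomP _ Gfc)[b ub]].
    by rewrite mul0r addr0; apply: h; apply: le_lt_trans ub (ltry _).
  have := h (u, - b); rewrite /= opprK mul0r addr0; apply.
  by rewrite ub.
have e1 : e < 0 by rewrite lt_neqAle e0 andbT; apply/eqP.
split=> // h; exfalso; have [u ud] := Gamma0_edom Gfc.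
have [a ua] := (edomP _ Gfc).1 ud.
(* Lowering the second coordinate by k raises the pairing above r, since e is negative. *)
pose k := (`|r - ip y u + a * e| + 1) / - e.
have k0 : 0 <= k by rewrite divr_ge0 ?addr_ge0// oppr_ge0 ltW.
have := h (u, - (a + k)); rewrite /= opprK ua lee_fin lerDl => /(_ k0).
have : k * e = - (`|r - ip y u + a * e| + 1).
  by rewrite /k; field; rewrite lt_eqF.
have := ler_norm (r - ip y u + a * e); lra.
Qed.

Lemma persp_Gamma0 : Gamma0 (persp f).
Proof.
have iP := hsum_inner_product ipP (mul_inner_product R).
have Gfc := fenchel_conj_Gamma0 ipP Gf.
apply: (affine_sup_Gamma0 iP
  (S := [set w | w.2 = 0 /\ (fc w.1.1 <= (- w.1.2 : R)%:E)%E])).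
- move=> w r; rewrite persp_le.
  split=> [h c _ /= [-> /h]|h c hc]; first by rewrite subr0.
  by have := h c 0; rewrite subr0; apply.
- have [u /(edomP _ Gfc)[a ua]] := Gamma0_edom Gfc.
  by exists ((u, - a) : hsum V R^o, 0); rewrite /= opprK ua.
- have [y /(edomP _ Gf)[a ya]] := Gamma0_edom Gf.
  by exists ((y, 1) : hsum V R^o), a; rewrite /persp /= ltr01 invr1 scale1r ya mul1e.
Qed.

Lemma persp_subgradient (w c : hsum V R^o) :
  persp f w = (hip w c)%:E -> (fc c.1 <= (- c.2 : R)%:E)%E ->
  subgradient hip (persp f) w c.
Proof.
have iP := hsum_inner_product ipP (mul_inner_product R).
move=> wE hc; exists (hip w c) => // y r /persp_le /(_ _ hc).
by rewrite !(ipE iP); lra.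
Qed.

End Recession.

(** * Values of g at its prox as the parameter varies *)

Section ProxValues.
Context {R : realType} {V : completeNormedModType R} {ip : V -> V -> R}.
Hypothesis ipP : inner_product ip.
Implicit Types (g : V -> \bar R) (z p : V) (a b l : R).

(** Each subgradient inequality is tested at the other point; the sum gives |p' - p|^2 <= (l - l')
    (a' - a). *)
Lemma prox_value_nonincreasing g z p p' a a' l l' : 0 < l -> l < l' ->
  g p = a%:E -> g p' = a'%:E ->
  subgradient ip g p (l^-1 *: (z - p)) ->
  subgradient ip g p' (l'^-1 *: (z - p')) -> a' <= a.
Proof.
move=> l0 ll' pa pa' [b pb h] [b' pb' h'].
have l'0 : 0 < l' by apply: lt_trans ll'.
have [ba ba'] : b = a /\ b' = a' by split; apply: EFin_inj; rewrite -?pb -?pb'.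
have := h p' a'; have := h' p a; rewrite pa pa' ba ba' => /(_ (lexx _)) h1 /(_ (lexx _)).
rewrite -lerBrDl (ipZr ipP) ler_pdivrMl// => h2.
move: h1; rewrite -lerBrDl (ipZr ipP) ler_pdivrMl// => h1.
have h3 := ip_ge0 ipP (p' - p).
rewrite leNgt; apply/negP => aa'.
have : l * (a' - a) < l' * (a' - a) by rewrite ltr_pM2r ?subr_gt0.
move: h1 h2 h3; rewrite !(ipE ipP) (ipC ipP p' p); lra.
Qed.

(** With P the projection, <P - p, z - p> is at least |P - p|^2 by the obtuse angle condition. This
    justifies the upper ends of both searches, [nu_max] and [mu_plus0]. *)
Lemma prox_value_le_proj g z p a b l : Gamma0 g -> 0 < l -> g p = a%:E ->
  subgradient ip g p (l^-1 *: (z - p)) ->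
  (g (proj_set (closure (edom g)) z) <= b%:E)%E -> a <= b.
Proof.
move=> Gg l0 pa [c pc h] /h; have -> : c = a by apply: EFin_inj; rewrite -pc.
have [_ /(_ p)] := proj_closure_edom ipP z Gg; set P := proj_set _ _.
have pd : edom g p by rewrite /edom /= pa ltry.
move=> /(_ pd) h1; apply: le_trans; rewrite lerDl (ipZr ipP).
rewrite mulr_ge0 ?invr_ge0 ?(ltW l0)//.
have := ip_ge0 ipP (P - p); move: h1.
by rewrite !(ipE ipP) (ipC ipP P p) (ipC ipP P z); lra.
Qed.

End ProxValues.

(** * The pair computed in one pass of the loop *)

Section BarPair.
Context {R : realType} {H : completeNormedModType R} {dot : H -> H -> R}.
Hypothesis dotP : inner_product dot.
Variables (f : H -> \bar R) (x : H) (eta : R).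
Hypothesis Gf : Gamma0 f.
Implicit Types (mu nu : R).

Local Notation fc := (fenchel_conj dot f).
Local Notation z := ((x, eta) : hsum H R^o).
Local Notation hip := (hsum_ip dot (fun a b : R^o => a * b : R)).

(** The root comes from projecting (x / mu, - eta / mu) onto the epigraph of the conjugate: the
    height gained there is nu / mu. *)
Lemma nu_hat_spec mu : 0 < mu -> ~~ (nu_max dot f x eta mu <= 0)%E ->
  exists p s, let nu := nu_hat dot f x eta mu in
  [/\ 0 < nu, nu = eta + mu * s, fc p = s%:E &
      subgradient dot fc p ((mu / nu) *: (mu^-1 *: x - p))].
Proof.
move=> mu0 numax; have Gfc := fenchel_conj_Gamma0 dotP Gf.
case E : (proj_set (epi fc) ((mu^-1 *: x, - eta / mu) : hsum H R^o)) => [p s].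
have := epi_proj_cases dotP Gfc (esym E); set t := - eta / mu in E *.
have mut : mu * t = - eta by rewrite mulrC divfK// gt_eqF.
case=> [[st pt pE]|[ts ps psub]].
  (* Without a gain in height, the conjugate at the projection onto its closed domain would be at
     most - eta / mu, making [nu_max] nonpositive. *)
  exfalso; move/negP: numax; apply; rewrite /nu_max -pE.
  have [a pa at_] := Gamma0_le_fin Gfc pt.
  rewrite pa -EFinM -EFinD lee_fin.
  have : mu * a <= mu * t by rewrite ler_pM2l.
  lra.
pose nu := eta + mu * s.
have nuE : nu / mu = s - t.
  by apply: (mulfI (lt0r_neq0 mu0)); rewrite mulrCA divff ?gt_eqF// mulr1 mulrBr
    mut opprK addrC.
have nu0 : 0 < nu by rewrite -(pmulr_lgt0 _ (_ : 0 < mu^-1)) ?invr_gt0// nuE subr_gt0.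
have psub' : subgradient dot fc p ((nu / mu)^-1 *: (mu^-1 *: x - p)) by rewrite nuE.
suff -> : nu_hat dot f x eta mu = nu.
  by exists p, s; split => //; rewrite invf_div in psub'.
have numu0 : 0 < nu / mu by rewrite divr_gt0.
apply: xget_unique => [|nu' [nu'0 _]].
  split => //.
    rewrite /nu_max; set P := proj_set _ _.
    have [[fcN _] _ _] := Gfc; case PE : (fc P) (fcN P) => [b| |] // _.
      rewrite -EFinM -EFinD lee_fin /nu lerD2l ler_pM2l//.
      by apply: (prox_value_le_proj dotP Gfc numu0 ps psub'); rewrite PE.
    by rewrite gt0_muley ?lte_fin// leey.
  rewrite /psi (prox_scale_eq dotP numu0 psub') ps -EFinM -EFinB.
  by congr EFin; rewrite /nu; lra.
have numu'0 : 0 < nu' / mu by rewrite divr_gt0.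
have := prox_scale_subgradient dotP (mu^-1 *: x) numu'0 Gfc.
rewrite /psi; set p' := prox _ _ => psub''.
have [b p'b _] := psub''; rewrite p'b -EFinM -EFinB => -[nu'E].
have nE : nu' - nu = mu * (b - s) by rewrite /nu; lra.
(* Uniqueness: a larger root would have a conjugate value no larger, while nu' - nu = mu (b - s)
   makes that value larger. *)
apply/eqP; rewrite eq_le; apply/andP; split; rewrite leNgt; apply/negP => lt.
- have h : nu / mu < nu' / mu by rewrite ltr_pM2r ?invr_gt0.
  have := prox_value_nonincreasing dotP numu0 h ps p'b psub' psub''.
  by rewrite -(ler_pM2l mu0); move: nE; rewrite mulrBr; lra.
- have h : nu' / mu < nu / mu by rewrite ltr_pM2r ?invr_gt0.
  have := prox_value_nonincreasing dotP numu'0 h p'b ps psub'' psub'.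
  by rewrite -(ler_pM2l mu0); move: nE; rewrite mulrBr; lra.
Qed.

(* bar_pair computes prox of mu * persp f through the Moreau decomposition:
   the dual variable (z - bar_pair) / mu is the projection of z / mu onto the
   reflected epigraph of the conjugate. *)
Lemma bar_pair_subgradient mu (w := bar_pair dot f x eta mu) : 0 < mu ->
  subgradient hip (persp f) w (mu^-1 *: (z - w)).
Proof.
move=> mu0; have Gfc := fenchel_conj_Gamma0 dotP Gf; rewrite /w /bar_pair.
case: ifPn => [|numax].
  rewrite /nu_max; set P := proj_set _ _ => hP.
  have [Pcl PE] := proj_closure_edom dotP (mu^-1 *: x) Gfc; rewrite -/P in Pcl PE.
  have xE : mu^-1 *: (x - (x - mu *: P)) = P.
    by rewrite opprB addrC subrK scalerA mulVf ?gt_eqF// scale1r.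
  have Pmax v : edom fc v -> dot (x - mu *: P) v <= dot (x - mu *: P) P.
    move=> /PE; rewrite -(ler_pM2l mu0) mulr0 -(ipZr dotP) scalerBr scalerA.
    rewrite divff ?gt_eqF// scale1r !(ipE dotP).
    by rewrite (ipC dotP v x) (ipC dotP P x) (ipC dotP v P); lra.
  (* Moreau's decomposition for the support function of the domain of the conjugate. *)
  rewrite (_ : prox _ x = x - mu *: P); last first.
    by apply: (prox_scale_eq dotP mu0); rewrite xE; exact: recession_subgradient.
  have -> : mu^-1 *: (z - (x - mu *: P, 0)) = (P, mu^-1 * eta) :> hsum H R^o.
    by congr pair; [exact: xE | rewrite /= subr0].
  (* The test of this branch says exactly that (P, eta / mu) lies in the reflected epigraph. *)
  have Pfin : (fc P <= (- (mu^-1 * eta))%R%:E)%E.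
    have [[fcN _] _ _] := Gfc; case: (fc P) (fcN P) hP => [b| |] // _.
      rewrite -EFinM -EFinD !lee_fin => h.
      rewrite -(ler_pM2l mu0) mulrN mulrA divff ?gt_eqF//.
      lra.
    by rewrite gt0_muley ?lte_fin// addey.
  apply: (persp_subgradient dotP Gf) => //.
  rewrite /persp ltxx eqxx /hsum_ip /= mul0r addr0.
  exact: recession_max.
have [p [s /= [nu0 nuE ps psub]]] := nu_hat_spec mu0 numax.
set nu := nu_hat _ _ _ _ _ in nu0 nuE psub *.
set q := (mu / nu) *: _ in psub.
have qE : nu *: q = x - mu *: p.
  rewrite /q scalerA mulrCA divff ?gt_eqF// mulr1 scalerBr scalerA.
  by rewrite divff ?gt_eqF// scale1r.
have qsub := fenchel_conj_subgradient dotP Gf psub.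
have numu0 : 0 < mu / nu by rewrite divr_gt0.
(* Here x / nu = (mu / nu) p + q with p a subgradient of f at q. *)
have -> : prox (fun y => (mu / nu)%:E * f y)%E (nu^-1 *: x) = q.
  apply: (prox_scale_eq dotP numu0); rewrite (_ : _ *: _ = p)//.
  have -> : nu^-1 *: x = (mu / nu) *: p + q.
    rewrite -(subrK (mu *: p) x) -qE scalerDr !scalerA mulVf ?gt_eqF// mul1r.
    by rewrite -/q addrC [nu^-1 * mu]mulrC.
  by rewrite addrK scalerA mulVf ?gt_eqF// scale1r.
have -> : mu^-1 *: (z - (nu *: q, nu)) = (p, - s) :> hsum H R^o.
  congr pair => /=.
    by rewrite qE opprB addrC subrK scalerA mulVf ?gt_eqF// scale1r.
  rewrite nuE opprD addNKr.
  by rewrite -[_ *: _]/(_ * _) mulrN mulKf ?gt_eqF.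
apply: (persp_subgradient dotP Gf); last by rewrite /= opprK ps.
rewrite /persp /= nu0 scalerA mulVf ?gt_eqF// scale1r.
have [a qa psE] := subgradient_fenchel_conj_val dotP qsub.
rewrite qa -EFinM /hsum_ip /= (ipZl dotP); congr EFin.
by have := psE; rewrite ps => -[->]; ring.
Qed.

Lemma bar_test_persp delta mu : 0 < mu ->
  bar_test dot f x eta delta mu =
  (persp f (bar_pair dot f x eta mu) < (mu + delta)%:E)%E.
Proof.
move=> mu0; rewrite /bar_test /bar_pair; case: ifPn => [_|numax].
  by rewrite /persp /= ltxx eqxx sube_gt0.
have [p [s /= [nu0 _ _ _]]] := nu_hat_spec mu0 numax.
by rewrite /persp /= nu0 sube_gt0.
Qed.

End BarPair.

(** * Error bound and correctness of the bisection *)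

(** With D = p - p' and w = z - p', monotonicity multiplied by l l' reads l' |D|^2 <= (l' - l) <D,
    w>; Cauchy-Schwarz concludes. *)
Lemma prox_parameter_le (R : realType) (V : completeNormedModType R)
    (ip : V -> V -> R) (g : V -> \bar R) (z p p' : V) (l l' : R) :
  inner_product ip -> 0 < l -> 0 < l' ->
  subgradient ip g p (l^-1 *: (z - p)) ->
  subgradient ip g p' (l'^-1 *: (z - p')) ->
  `|p - p'| <= `|l - l'| / l' * `|z - p'|.
Proof.
move=> ipP l0 l'0 pz pz'; have := subgradient_monotone ipP pz pz'.
rewrite (_ : z - p = (z - p') - (p - p')); last by rewrite opprB addrA subrK.
move: (p - p') (z - p') => D w.
rewrite !(ipE ipP) => h.
have {h} : l' * ip D D <= (l' - l) * ip D w.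
  have : 0 <= l * l' * (l^-1 * (ip D w - ip D D) - l'^-1 * ip D w).
    by apply: mulr_ge0; [apply: mulr_ge0; exact: ltW | exact: h].
  rewrite (_ : _ * _ = l' * (ip D w - ip D D) - l * ip D w); first lra.
  by field; rewrite !gt_eqF.
rewrite -(norm2_ip ipP) => h; rewrite mulrAC ler_pdivlMr// mulrC.
have [->|D0] := eqVneq D 0; first by rewrite normr0 mulr0 mulr_ge0.
have d0 : 0 < `|D| by rewrite normr_gt0.
rewrite -(ler_pM2r d0) -mulrA -expr2; apply: le_trans h _.
apply: le_trans (ler_norm _) _; rewrite normrM distrC -mulrA ler_wpM2l//.
by rewrite mulrC; exact: ip_norm_le.
Qed.

Lemma exists_expr_gt (R : realType) (N a : R) : 1 < N -> exists k, a < N ^+ k.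
Proof.
move=> N1; have N0 : 0 < N - 1 by rewrite subr_gt0.
have bern k : 1 + k%:R * (N - 1) <= N ^+ k.
  elim: k => [|k IH]; first by rewrite mul0r addr0.
  have : 0 <= k%:R * (N - 1) * (N - 1) by rewrite !mulr_ge0// ltW.
  by rewrite exprS -natr1; nra.
exists (Num.truncn (a / (N - 1))).+1; apply: lt_le_trans (bern _).
have := truncnS_gt (a / (N - 1)); rewrite ltr_pdivrMr//; lra.
Qed.

Section BisectionCorrect.
Context {R : realType} {H : completeNormedModType R} {dot : H -> H -> R}.
Hypothesis dotP : inner_product dot.
Variables (f : H -> \bar R) (x : H) (eta delta : R).
Hypothesis Gf : Gamma0 f.

Local Notation z := ((x, eta) : hsum H R^o).
Local Notation hip := (hsum_ip dot (fun a b : R^o => a * b : R)).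
Local Notation g := (persp f).

(** In the theorem [mus] is the height [deltas - delta] gained by the epigraph projection. *)
Variables (zs : hsum H R^o) (mus : R).
Hypotheses (mus_gt0 : 0 < mus) (zsE : g zs = (mus + delta)%:E)
  (zs_sub : subgradient hip g zs (mus^-1 *: (z - zs))).

Let iP : inner_product hip := hsum_inner_product dotP (mul_inner_product R).
Let Gg : Gamma0 g := persp_Gamma0 dotP Gf.

(** The value at the prox minus mu + delta strictly decreases in mu and vanishes at [mus], where the
    prox is [zs]. *)
Lemma persp_prox_lt mu p : 0 < mu -> subgradient hip g p (mu^-1 *: (z - p)) ->
  (g p < (mu + delta)%:E)%E = (mus < mu).
Proof.
move=> mu0 psub; have [a pa _] := psub; rewrite pa lte_fin.
have [mumus|mumus|mumus] := ltgtP mu mus.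
- have := prox_value_nonincreasing iP mu0 mumus pa zsE psub zs_sub.
  by move=> h; apply/negbTE; rewrite -leNgt; lra.
- have := prox_value_nonincreasing iP mus_gt0 mumus zsE pa zs_sub psub.
  by move=> h; lra.
- rewrite mumus in psub.
  have pzs : p = zs.
    by rewrite -(prox_scale_eq iP mus_gt0 psub) (prox_scale_eq iP mus_gt0 zs_sub).
  have [<-] : (mus + delta)%:E = a%:E by rewrite -zsE -pzs.
  by rewrite mumus ltxx.
Qed.

Lemma bar_testE mu : 0 < mu -> bar_test dot f x eta delta mu = (mus < mu).
Proof.
move=> mu0; rewrite (bar_test_persp dotP _ _ Gf)//.
by rewrite persp_prox_lt//; exact: bar_pair_subgradient.
Qed.

Lemma phi_gt0 mu : 0 < mu -> (0 < phi f x eta delta mu)%E = (mus < mu).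
Proof.
move=> mu0; rewrite /phi; have psub := prox_scale_subgradient iP z mu0 Gg.
have [a pa _] := psub; rewrite sube_gt0; exact: persp_prox_lt.
Qed.

(** Either [prox_value_le_proj] applies, or the powers of N eventually exceed [mus], so that the
    exponent sought exists and the default of [xget] is not taken. *)
Lemma mu_plus0_ge N : 1 < N -> mus <= mu_plus0 f x eta delta N.
Proof.
move=> N1; rewrite /mu_plus0; case: ifPn => [/set_mem|_].
  move=> /(edomP _ Gg)[b pb]; rewrite pb /= addrC lerBrDr.
  by apply: (prox_value_le_proj iP Gg mus_gt0 zsE zs_sub); rewrite pb.
have N0 k : 0 < N ^+ k by rewrite exprn_gt0// (lt_trans _ N1).
have [k musk] := exists_expr_gt mus N1.
have ex : exists k, mus < N ^+ k by exists k.
pose P k := (0 < phi f x eta delta (N ^+ k))%E /\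
  forall j, (j < k)%N -> ~ (0 < phi f x eta delta (N ^+ j))%E.
have : P (first_exponent f x eta delta N).
  apply: xgetPex; case: (ex_minnP ex) => m hm mmin.
  exists m; split=> [|j jm]; rewrite phi_gt0// => /mmin.
  by rewrite leqNgt jm.
by move=> [+ _]; rewrite phi_gt0// => /ltW.
Qed.

Lemma bracketP N n (b := bracket dot f x eta delta N n) : 1 < N ->
  [/\ 0 <= b.1, b.1 <= mus <= b.2 & b.2 - b.1 = mu_plus0 f x eta delta N / 2 ^+ n].
Proof.
move=> N1; rewrite {}/b /bracket; elim: n => [|n] /=.
  by rewrite expr0 divr1 subr0 lexx (ltW mus_gt0) mu_plus0_ge.
set c := iter _ _ _; move=> [c1 /andP[lo hi] E].
(* The lower end may be 0, but the upper end is at least [mus]. *)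
have mid0 : 0 < midpoint c by rewrite /midpoint; move: mus_gt0; lra.
have E2 : mu_plus0 f x eta delta N / 2 ^+ n.+1 = (c.2 - c.1) / 2.
  by rewrite E exprS invfM mulrA mulrAC.
rewrite /bisect bar_testE// E2; case: ltP => h /=; split => //; rewrite ?(ltW mid0)//.
- by rewrite lo ltW.
- by rewrite /midpoint; lra.
- by rewrite h.
- by rewrite /midpoint; lra.
Qed.

Lemma midpoint_bracketP N eps
    (mu := midpoint (bracket dot f x eta delta N (last_step f x eta delta N eps))) :
  1 < N -> 0 < eps -> 0 < mu /\ `|mus - mu| <= eps.
Proof.
move=> N1 e0; rewrite /mu; set m := last_step _ _ _ _ _ _.
have [b1 /andP[lo hi]] := bracketP m N1; set b := bracket _ _ _ _ _ _ _ in b1 lo hi *.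
set M := mu_plus0 _ _ _ _ _ => E.
(* The returned midpoint halves a bracket of width M / 2^m, so the error is at most M / 2^(m+1);
   this bound also covers M < eps, where m = 0. *)
have mlt : ln (M / eps) / ln 2 < m.+1%:R := truncnS_gt _.
have M0 : 0 < M by apply: lt_le_trans (mu_plus0_ge N1).
clearbody m b M.
have : M / eps < 2 ^+ m.+1.
  rewrite -ltr_ln ?posrE ?divr_gt0 ?exprn_gt0// lnXn// -[ln 2 *+ _]mulr_natl.
  by rewrite -ltr_pdivrMr ?ln_gt0 ?ltr1n.
rewrite ltr_pdivrMr// exprS => h.
have h2 : b.2 - b.1 <= 2 * eps.
  by rewrite E ler_pdivrMr ?exprn_gt0// mulrAC ltW.
rewrite /midpoint ler_norml; move: mus_gt0 => mus0; split; first lra.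
by apply/andP; split; lra.
Qed.

End BisectionCorrect.

Theorem theorem3p2 (R : realType) (H : completeNormedModType R)
  (dot : {dot H for idfun}) (dot_norm : forall y : H, `|y| ^+ 2 = dot y y)
  (f : H -> \bar R) (f_Gamma0 : Gamma0 f)
  (x : H) (eta delta N eps : R) (N_gt1 : 1 < N) (eps_gt0 : 0 < eps)
  (z : hsum H R^o) (z_def : z = (x, eta))
  (delta_lt : (delta%:E < persp f (proj_set (closure (edom (persp f))) z))%E)
  (zs zb : hsum H R^o) (deltas deltab : R)
  (star_def : (zs, deltas) = proj_set (epi (persp f)) (z, delta))
  (bar_def : (zb, deltab) = bisection dot f x eta delta N eps) :
  `|deltas - deltab| <= eps /\
  `|zs - zb| <= eps / (deltab - delta) * `|z - zb|.
Proof.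
have dotP := dot_inner_product dot_norm.
have iP := hsum_inner_product dotP (mul_inner_product R).
have Gg := persp_Gamma0 dotP f_Gamma0.
(* A projection at height [delta] would lie over the projection of z onto the closed domain, with
   value at most [delta], against [delta_lt]. *)
have [[_ zsle zsE]|[lt_s zsE zs_sub]] := epi_proj_cases iP Gg star_def.
  by move: delta_lt; rewrite -zsE ltNge zsle.
rewrite z_def in zs_sub *.
have mus0 : 0 < deltas - delta by rewrite subr_gt0.
have zsE' : persp f zs = (deltas - delta + delta)%:E by rewrite subrK.
have [mu0 le_eps] := midpoint_bracketP dotP f_Gamma0 mus0 zsE' zs_sub N_gt1 eps_gt0.
move: bar_def mu0 le_eps; rewrite /bisection; set mu := midpoint _.
move=> [-> ->] mu0 le_eps; split; first by rewrite opprD addrA.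
have zb_sub := bar_pair_subgradient dotP x eta f_Gamma0 mu0.
rewrite [delta + mu]addrC addrK.
apply: le_trans (prox_parameter_le iP mus0 mu0 zs_sub zb_sub) _.
by rewrite ler_wpM2r// ler_pM2r// invr_gt0.
Qed.
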